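(* Let $R_0>0$, $T>0$, $D=[0,R_0]$, and let $L^2(D)$ denote the weighted space $L^2([0,R_0];r^2)$ with norm $\|\phi\|=\left(\int_0^{R_0} r^2|\phi(r)|^2\,dr\right)^{1/2}$. Let $\lambda_n=(n\pi/R_0)^2$ and $\omega_n(r)=\frac{\sqrt2\, n\pi}{\sqrt{R_0^3}}\frac{\sin(n\pi r/R_0)}{n\pi r/R_0}$, $n\ge1$, which form a complete orthonormal system of $L^2([0,R_0];r^2)$. Let $a:[0,T]\to\mathbb{R}$ satisfy $0<a_0\le a(t)\le a_1$ for constants $a_0,a_1$. Let $B^H$ be a fractional Brownian motion with Hurst index $H\in(0,1)$ on a complete probability space. Assume $f,g\in L^2(D)$ with $\|g\|_{L^2(D)}\neq0$, and $h\in L^\infty(0,T)$ with $h\ge C(h)>0$ a.e. on $(0,T)$ for some constant $C(h)$. Let $f_n=\int_0^{R_0}r^2f(r)\omega_n(r)\,dr$, $g_n=\int_0^{R_0}r^2g(r)\omega_n(r)\,dr$, and let $u$ be the mild solution $$u(r,t)=\sum_{n=1}^\infty\Big[f_n\int_0^t h(\tau)e^{-\lambda_n\int_\tau^t a(s)ds}\,d\tau+g_n\int_0^t e^{-\lambda_n\int_\tau^t a(s)ds}\,dB^H(\tau)\Big]\omega_n(r).$$ Then there is a constant $C>0$, not depending on $f,g,h$, such that $$\mathbb{E}\Big[\|u\|^2_{L^2(D\times[0,T])}\Big]\le C\Big(T^3\|f\|^2_{L^2(D)}\|h\|^2_{L^\infty(0,T)}+\frac{T^{2H+1}}{2H+1}\|g\|^2_{L^2(D)}\Big),$$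 where $\|u\|^2_{L^2(D\times[0,T])}=\int_0^T\|u(\cdot,t)\|^2_{L^2(D)}\,dt$.
   Context: The mild solution is that of the problem $u_t=a(t)[u_{rr}+\frac{2}{r}u_r]+f(r)h(t)+g(r)\dot B^H(t)$ on $0<r<R_0$, $0<t<T$, with $u(r,0)=0$, $u(R_0,t)=0$, $u$ bounded as $r\to0$. A fractional Brownian motion $B^H$ is a centered Gaussian process with $B^H(0)=0$ and covariance $\mathbb{E}[B^H(t)B^H(s)]=\frac12(t^{2H}+s^{2H}-|t-s|^{2H})$; the integrals $\int_0^t\psi(\tau)\,dB^H(\tau)$ of deterministic integrands are Wiener integrals with respect to $B^H$. *)

(* Defs.v *)
From HB Require Import structures.
From mathcomp Require Import all_boot all_order all_algebra.
From mathcomp Require Import all_classical all_reals all_analysis ess_sup_inf.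
Set Implicit Arguments. Unset Strict Implicit. Unset Printing Implicit Defensive.
Import Order.TTheory GRing.Theory Num.Theory.
Import numFieldNormedType.Exports.
Local Open Scope classical_set_scope.
Local Open Scope ring_scope.

Section defs.
Context {R : realType}.

Definition L2w_sq (R0 : R) (phi : R -> R) : \bar R :=
  (\int[lebesgue_measure]_(r in `[0%R, R0]) ((r ^+ 2 * (phi r) ^+ 2)%:E))%E.

Definition inL2w (R0 : R) (phi : R -> R) : Prop :=
  measurable_fun `[0%R, R0] phi /\ (L2w_sq R0 phi < +oo)%E.

Definition Linf_norm (T : R) (h : R -> R) : \bar R :=
  ess_sup lebesgue_measure
    (fun t => ((if t \in `]0%R, T[ then `|h t| else 0))%:E).

Definition inLinf (T : R) (h : R -> R) : Prop :=
  measurable_fun `]0%R, T[ h /\ (Linf_norm T h < +oo)%E.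

Definition lam (R0 : R) (n : nat) : R := (n%:R * pi / R0) ^+ 2.

Definition omega (R0 : R) (n : nat) (r : R) : R :=
  if r == 0 then Num.sqrt 2 * (n%:R * pi) / Num.sqrt (R0 ^+ 3)
  else Num.sqrt 2 * (n%:R * pi) / Num.sqrt (R0 ^+ 3)
       * (sin (n%:R * pi * r / R0) / (n%:R * pi * r / R0)).

Definition coef (R0 : R) (phi : R -> R) (n : nat) : R :=
  Rintegral lebesgue_measure `[0%R, R0] (fun r => r ^+ 2 * phi r * omega R0 n r).

Definition Aint (a : R -> R) (tau t : R) : R :=
  Rintegral lebesgue_measure `[tau, t]%classic a.

Context {d : measure_display} {Omega : measurableType d}.

Definition gaussian_rv (P : probability Omega R) (Y : Omega -> R) : Prop :=
  exists m s : R,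
    (s = 0 /\ forall A : set R, measurable A -> P (Y @^-1` A) = dirac m A) \/
    (0 < s /\ forall A : set R, measurable A -> P (Y @^-1` A) = normal_prob m s A).

Definition fBm_cov (H t s : R) : R :=
  2^-1 * (t `^ (2 * H) + s `^ (2 * H) - `|t - s| `^ (2 * H)).

Definition is_fBm (P : probability Omega R) (H : R) (B : R -> Omega -> R) : Prop :=
  [/\ (forall w, B 0 w = 0),
      (forall t, measurable_fun setT (B t)),
      (forall (k : nat) (c : 'I_k -> R) (ts : 'I_k -> R), (forall i, 0 <= ts i) ->
          gaussian_rv P (fun w => \sum_(i < k) c i * B (ts i) w)),
      (forall t, 0 <= t -> (\int[P]_w (B t w)%:E = 0)%E) &
      (forall t s, 0 <= t -> 0 <= s ->
          (\int[P]_w (B t w * B s w)%:E = (fBm_cov H t s)%:E)%E)].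

Definition riemann_sum (B : R -> Omega -> R) (psi : R -> R) (t : R) (N : nat)
    (w : Omega) : R :=
  \sum_(k < N) psi (t * k%:R / N%:R) *
     (B (t * k.+1%:R / N%:R) w - B (t * k%:R / N%:R) w).

Definition wiener_integral (P : probability Omega R) (B : R -> Omega -> R)
    (psi : R -> R) (t : R) (X : Omega -> R) : Prop :=
  measurable_fun setT X /\
  ((fun N : nat => (\int[P]_w (((X w - riemann_sum B psi t N w) ^+ 2)%:E))%E)
     @ \oo --> 0%E).

End defs.

(* Main.v *)
Require Import Defs.
From HB Require Import structures.
From mathcomp Require Import all_boot all_order all_algebra.
From mathcomp Require Import ring lra.
From mathcomp Require Import all_classical all_reals all_analysis ess_sup_inf measurable_realfun.
Import Order.TTheory GRing.Theory Num.Theory.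
Import numFieldNormedType.Exports.
Local Open Scope classical_set_scope.
Local Open Scope ring_scope.

(** Since [r * omega_n(r)] is a multiple of [sin (n pi r / R0)], the [omega_n]
    are orthonormal, so the squared norm of a partial sum of the series is the
    sum of its squared coefficients.  The kernel
    [exp (- lam_n * \int_tau^t a)] is nondecreasing in [tau] with values in
    [[0, 1]].  Hence the deterministic coefficient is at most [T * |h|_oo], and
    summation by parts in the Riemann sums bounds the second moment of the
    Wiener integral by [8 t^(2H)] uniformly in [n] and for every [H].  Bessel's
    inequality then bounds the partial sums, and
    [|u|^2 <= 2 |u - S_N|^2 + 2 |S_N|^2] passes the bound to the limit. *)

(** * Integrals of nonnegative functions without measurability *)

Section lower_integral.
Local Open Scope ereal_scope.
Context {d : measure_display} {T : measurableType d} {R : realType}.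
Variables (mu : {measure set T -> \bar R}) (D : set T).
Implicit Types f g h : T -> \bar R.

Import HBNNSimple.

(** A larger integrand has more simple functions below it, so the supremum defining the integral
    grows; the argument covers arbitrary nonnegative functions. *)
Lemma le_lower_integral f g :
  (forall x, D x -> 0 <= f x) -> (forall x, D x -> f x <= g x) ->
  \int[mu]_(x in D) f x <= \int[mu]_(x in D) g x.
Proof.
move=> f0 fg.
have g0 x : D x -> 0 <= g x by move=> Dx; exact: le_trans (f0 _ Dx) (fg _ Dx).
rewrite !ge0_integralE//; apply: ge_ereal_sup => _ [s /= sf <-].
apply: ereal_sup_ubound; exists s => //= x; apply: le_trans (sf x) _.
rewrite !patchE; case: ifPn => // /set_mem; exact: fg.
Qed.

(* The nonnegative integral is a supremum over simple functions [s <= h], and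
   [(s - g)^+ / c] is a measurable minorant of [f]; so neither [f] nor [h] has
   to be measurable. *)
Lemma le_lower_integral_affine (c : R) f g h : measurable D -> (0 < c)%R ->
  (forall x, D x -> 0 <= f x) -> (forall x, D x -> 0 <= g x) ->
  (forall x, D x -> 0 <= h x) -> measurable_fun D g ->
  (forall x, D x -> h x <= c%:E * f x + g x) ->
  \int[mu]_(x in D) h x <= c%:E * \int[mu]_(x in D) f x + \int[mu]_(x in D) g x.
Proof.
move=> mD c0 f0 g0 h0 mg hfg.
have ci0 : (0 <= c^-1)%R by rewrite invr_ge0 ltW.
rewrite [X in X <= _]ge0_integralE//; apply: ge_ereal_sup => _ [s /= sh <-].
rewrite -integralT_nnsfun.
(* Off [D], [s] lies between 0 and the zero extension of [h], so it vanishes there. *)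
have -> : \int[mu]_x (s x)%:E = \int[mu]_(x in D) (s x)%:E.
  rewrite [RHS]integral_mkcond; apply: eq_integral => x _; rewrite patchE.
  case: ifPn => // xD; apply/eqP; rewrite eq_le; apply/andP; split.
    by have := sh x; rewrite patchE (negbTE xD).
  by rewrite lee_fin.
have ms : measurable_fun D (fun x => (s x)%:E).
  by apply/measurable_EFinP; exact: measurable_funTS.
pose k x := c^-1%:E * maxe ((s x)%:E - g x) 0.
have k0 x : D x -> 0 <= k x.
  by move=> _; rewrite mule_ge0 ?lee_fin// le_max lexx orbT.
have mk : measurable_fun D k.
  apply: measurable_funeM; apply: measurable_maxe => //.
  exact: emeasurable_funB.
have ck x : c%:E * k x = maxe ((s x)%:E - g x) 0.
  by rewrite /k muleA -EFinM divff ?gt_eqF// mul1e.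
have kf x : D x -> k x <= f x.
  move=> Dx; rewrite /k lee_pdivrMl// ge_max mule_ge0 ?f0 ?andbT//; last first.
    by rewrite lee_fin ltW.
  have := sh x; rewrite patchE mem_set// => /le_trans /(_ (hfg _ Dx)).
  (* Where [g] is finite this is [s <= c f + g] rearranged; where [g] is infinite, [s - g] is minus
     infinity. *)
  have := g0 _ Dx; case: (g x) => [r _ ?|_ _|//]; first by rewrite leeBlDr.
  by rewrite addeNy leNye.
apply: (@le_trans _ _ (c%:E * \int[mu]_(x in D) k x + \int[mu]_(x in D) g x)).
  rewrite -ge0_integralZl//; last by rewrite lee_fin ltW.
  rewrite -ge0_integralD//.
  - apply: ge0_le_integral => //.
    + by move=> x _; rewrite lee_fin.
    + by apply: emeasurable_funD => //; exact: measurable_funeM.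
    + move=> x Dx; rewrite ck.
      have := g0 _ Dx; case: (g x) => [r r0|_|//]; last first.
        by rewrite addey ?leey// -ltNye lt_max ltNyr orbT.
      by rewrite -leeBlDr// le_max lexx.
  - by move=> x Dx; rewrite mule_ge0 ?k0// lee_fin ltW.
  - exact: measurable_funeM.
rewrite leeD2r// lee_pmul2l//; exact: le_lower_integral.
Qed.

End lower_integral.

(** * Weighted squares and summation by parts *)

Section finite_sums.
Context {R : realFieldType}.

(** Jensen's inequality for weights of total mass at most 1: expand the nonnegative sum of
    [q k * (y k - m) ^+ 2] with [m] the weighted sum. Missing mass only lowers the term in
    [m ^+ 2]. *)
Lemma sqr_convex_sum_le n (q y : nat -> R) : (forall k, (k < n)%N -> 0 <= q k) ->
  \sum_(k < n) q k <= 1 ->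
  (\sum_(k < n) q k * y k) ^+ 2 <= \sum_(k < n) q k * y k ^+ 2.
Proof.
move=> q0 q1.
have E m : \sum_(k < n) q k * (y k - m) ^+ 2 =
    \sum_(k < n) q k * y k ^+ 2 - 2 * m * (\sum_(k < n) q k * y k)
    + m ^+ 2 * \sum_(k < n) q k.
  rewrite !mulr_sumr -sumrN -!big_split/=.
  by apply: eq_bigr => k _; ring.
set m := \sum_(k < n) q k * y k.
have : 0 <= \sum_(k < n) q k * (y k - m) ^+ 2.
  by apply: sumr_ge0 => k _; rewrite mulr_ge0 ?q0 ?sqr_ge0.
rewrite E -/m.
have : m ^+ 2 * \sum_(k < n) q k <= m ^+ 2 by rewrite ler_piMr ?sqr_ge0.
by rewrite expr2; lra.
Qed.

(** Abel summation moves the differences from [x] to [p], with no boundary term at 0. The increments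
    of [p] are nonnegative and telescope to at most 1, so Jensen applies to them; the factor 2
    separates off the last boundary term. *)
Lemma sqr_sum_increments_le n (p x : nat -> R) : x 0%N = 0 ->
  (forall k, (k <= n)%N -> 0 <= p k <= 1) ->
  (forall k, (k < n)%N -> p k <= p k.+1) ->
  (\sum_(k < n.+1) p k * (x k.+1 - x k)) ^+ 2 <=
  2 * x n.+1 ^+ 2 + 2 * \sum_(k < n) (p k.+1 - p k) * x k.+1 ^+ 2.
Proof.
move=> x0 p01 pnd.
have -> : \sum_(k < n.+1) p k * (x k.+1 - x k) =
    p n * x n.+1 - \sum_(k < n) (p k.+1 - p k) * x k.+1.
  elim: n {p01 pnd} => [|n IH]; first by rewrite big_ord_recr !big_ord0/= x0; ring.
  by rewrite big_ord_recr/= IH big_ord_recr/=; ring.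
have : (\sum_(k < n) (p k.+1 - p k) * x k.+1) ^+ 2 <=
       \sum_(k < n) (p k.+1 - p k) * x k.+1 ^+ 2.
  apply: (@sqr_convex_sum_le _ (fun k => p k.+1 - p k) (fun k => x k.+1)).
    by move=> k kn; rewrite subr_ge0 pnd.
  rewrite -(big_mkord xpredT (fun k => p k.+1 - p k)) telescope_sumr//.
  have /andP[_ ?] := p01 n (leqnn _); have /andP[? _] := p01 0%N (leq0n _); lra.
have : (p n * x n.+1) ^+ 2 <= x n.+1 ^+ 2.
  have /andP[? ?] := p01 n (leqnn _).
  by rewrite exprMn ler_piMl ?sqr_ge0// expr_le1.
set a := p n * _; set b := \sum_(k < n) _; set c := \sum_(k < n) _ => h1 h2.
have := sqr_ge0 (a + b); nra.
Qed.

End finite_sums.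

(** Serves both limits: Riemann sums tending to the Wiener integral, and partial sums tending to
    [u]. *)
Lemma cvg0_affine_le {R : realType} (c K : R) (x : \bar R) (v : nat -> \bar R) :
  v @ \oo --> 0%E -> (forall n, (x <= c%:E * v n + K%:E)%E) -> (x <= K%:E)%E.
Proof.
move=> v0 xv.
have : (fun n => (c%:E * v n + K%:E)%E) @ \oo --> (c%:E * 0 + K%:E)%E.
  by apply: cvgeD; [exact: fin_num_adde_defl|exact: cvgeZl|exact: cvg_cst].
rewrite mule0 add0e => /cvge_to_ge; apply; exact: nearW.
Qed.

(** * Second moments for fractional Brownian motion *)

Section fractional_brownian_motion.
Context {R : realType} {d : measure_display} {Omega : measurableType d}.
Variables (P : probability Omega R) (H : R) (B : R -> Omega -> R).
Hypotheses (H_gt0 : 0 < H) (fBm : is_fBm P H B).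

Let mB t : measurable_fun setT (B t).
Proof. by case: fBm. Qed.

Lemma fBm_scaled_second_moment (c t : R) : 0 <= c -> 0 <= t ->
  (\int[P]_w (c * B t w ^+ 2)%:E = (c * t `^ (2 * H))%:E)%E.
Proof.
move=> c0 t0; under eq_integral do rewrite EFinM.
rewrite ge0_integralZl_EFin//; last 2 first.
- by move=> w _; rewrite lee_fin sqr_ge0.
- by apply/measurable_EFinP; exact: measurable_funX.
case: fBm => _ _ _ _ /(_ t t t0 t0) ->; rewrite -EFinM; congr (_ * _)%:E.
(* By convention 0 to the power 0 is 1, so dropping |t - t|^(2H) uses that [H] is nonzero. *)
rewrite /fBm_cov subrr normr0 powR0 ?mulf_neq0 ?gt_eqF// subr0; lra.
Qed.

Lemma riemann_sum_measurable (psi : R -> R) (t : R) N :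
  measurable_fun setT (riemann_sum B psi t N).
Proof.
apply: measurable_sum => k; apply: measurable_funM => //.
exact: measurable_funB.
Qed.

(* Summation by parts writes the Riemann sum as a combination of values of [B]
   whose coefficients have total mass at most 2, so only the variances of [B]
   enter and the bound is the same for all [0 < H < 1]. *)
Lemma riemann_sum_second_moment_le (psi : R -> R) (t : R) N : 0 <= t ->
  (forall x, 0 <= x <= t -> 0 <= psi x <= 1) ->
  (forall x y, 0 <= x -> x <= y -> y <= t -> psi x <= psi y) ->
  (\int[P]_w (riemann_sum B psi t N w ^+ 2)%:E <= (4 * t `^ (2 * H))%:E)%E.
Proof.
(* The empty subdivision gives the sum 0; otherwise the nodes [s k] lie in [0, t] and start at 0,
   where [B] vanishes. *)
move=> t0 psi01 psi_nd; case: N => [|n].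
  rewrite integral0_eq; last by move=> w _; rewrite /riemann_sum big_ord0 expr0n.
  by rewrite lee_fin mulr_ge0// powR_ge0.
pose s k : R := t * k%:R / n.+1%:R.
have s0 k : 0 <= s k by rewrite divr_ge0// mulr_ge0.
have sS k : s k <= s k.+1.
  by rewrite ler_wpM2r ?invr_ge0// ler_wpM2l// ler_nat.
have st k : (k <= n.+1)%N -> s k <= t.
  by move=> kn; rewrite ler_pdivrMr ?ltr0n// ler_wpM2l// ler_nat.
have p01 k : (k <= n)%N -> 0 <= psi (s k) <= 1.
  by move=> kn; rewrite psi01// s0 st// leqW.
have pnd k : (k < n)%N -> psi (s k) <= psi (s k.+1).
  by move=> kn; rewrite psi_nd// st// ltnW.
pose q k := psi (s k.+1) - psi (s k).
have q0 (k : 'I_n) : 0 <= 2 * q k by rewrite mulr_ge0// subr_ge0 pnd.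
apply: (@le_trans _ _ (\int[P]_w ((2 * B (s n.+1) w ^+ 2)%:E +
    \sum_(k < n) (2 * q k * B (s k.+1) w ^+ 2)%:E))%E).
  apply: le_lower_integral => w _; first by rewrite lee_fin sqr_ge0.
  rewrite sumEFin -EFinD lee_fin.
  have Bs0 : B (s 0%N) w = 0.
    by rewrite /s mulr0 mul0r; case: fBm => ->.
  apply: le_trans (@sqr_sum_increments_le _ n _ (fun k => B (s k) w) Bs0 p01 pnd) _.
  by rewrite lerD2l mulr_sumr; apply: ler_sum => k _; rewrite mulrA.
have msq c t' : measurable_fun setT (fun w => (c * B t' w ^+ 2)%:E).
  by apply/measurable_EFinP/measurable_funM => //; exact: measurable_funX.
rewrite ge0_integralD//; last 3 first.
- by move=> w _; rewrite lee_fin mulr_ge0// sqr_ge0.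
- by move=> w _; apply: sume_ge0 => k _; rewrite lee_fin mulr_ge0// sqr_ge0.
- exact: emeasurable_sum.
rewrite ge0_integral_sum//; last first.
  by move=> k w _; rewrite lee_fin mulr_ge0// sqr_ge0.
rewrite fBm_scaled_second_moment//.
rewrite (eq_bigr (fun k : 'I_n => (2 * q k * s k.+1 `^ (2 * H))%:E)); last first.
  by move=> k _; rewrite fBm_scaled_second_moment.
rewrite sumEFin -EFinD lee_fin.
have sH k : (k <= n.+1)%N -> s k `^ (2 * H) <= t `^ (2 * H).
  move=> kn; apply: ge0_ler_powR; rewrite ?nnegrE ?st//.
  by rewrite mulr_ge0// ltW.
have : \sum_(k < n) 2 * q k * s k.+1 `^ (2 * H) <=
       \sum_(k < n) 2 * q k * t `^ (2 * H).
  by apply: ler_sum => k _; rewrite ler_wpM2l// sH// leqW.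
rewrite -mulr_suml -mulr_sumr -(big_mkord xpredT q) telescope_sumr//.
have /andP[_ pn1] := p01 n (leqnn _); have /andP[p00 _] := p01 0%N (leq0n _).
have := sH n.+1 (leqnn _); have := powR_ge0 t (2 * H).
set z := t `^ _; set z' := _ `^ _ => z0 zz' h.
(* The weights [q] telescope to at most 1, so the last value and the weighted sum contribute [2 * z]
   each: this is the constant 4. *)
have : (psi (s n) - psi (s 0%N)) * z <= 1 * z by rewrite ler_wpM2r//; lra.
by lra.
Qed.

(** With S a Riemann sum, X^2 <= 2 (X - S)^2 + 2 S^2. The bound on S is uniform in the mesh while
    the error vanishes, so 8 is twice the constant for Riemann sums. *)
Lemma wiener_integral_second_moment_le (psi : R -> R) (t : R) (X : Omega -> R) :
  0 <= t -> (forall x, 0 <= x <= t -> 0 <= psi x <= 1) ->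
  (forall x y, 0 <= x -> x <= y -> y <= t -> psi x <= psi y) ->
  wiener_integral P B psi t X ->
  (\int[P]_w (X w ^+ 2)%:E <= (8 * t `^ (2 * H))%:E)%E.
Proof.
move=> t0 psi01 psi_nd [mX XS]; apply: (@cvg0_affine_le _ 2 _ _ _ XS) => N.
have mS := @riemann_sum_measurable psi t N.
apply: le_trans (le_lower_integral_affine P setT 2 (fun w =>
    ((X w - riemann_sum B psi t N w) ^+ 2)%:E) (fun w =>
    (2%:E * (riemann_sum B psi t N w ^+ 2)%:E)%E) _ _ _ _ _ _ _ _) _ => //.
- by move=> w _; rewrite lee_fin sqr_ge0.
- by move=> w _; rewrite -EFinM lee_fin mulr_ge0// sqr_ge0.
- by move=> w _; rewrite lee_fin sqr_ge0.
- by apply: measurable_funeM; apply/measurable_EFinP; exact: measurable_funX.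
- move=> w _; rewrite -!EFinM -EFinD lee_fin.
  set x := X w; set y := riemann_sum _ _ _ _ _.
  by have := sqr_ge0 (x - 2 * y); nra.
- rewrite leeD2l// ge0_integralZl_EFin//; last 2 first.
  + by move=> w _; rewrite lee_fin sqr_ge0.
  + by apply/measurable_EFinP; exact: measurable_funX.
  have -> : (8 * t `^ (2 * H))%:E = (2%:E * (4 * t `^ (2 * H))%:E)%E.
    by rewrite -EFinM; congr EFin; lra.
  by rewrite lee_pmul2l//; exact: riemann_sum_second_moment_le.
Qed.

End fractional_brownian_motion.

(** * Bounds by the essential supremum *)

Section bounded_integrals.
Context {R : realType}.
Local Notation mu := (@lebesgue_measure R).

(** [Rintegral] is the difference of the integrals of the positive and negative parts. Each lies
    between 0 and [M * fine (nu D)] by monotonicity, hence so does the absolute value of the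
    difference. Measurability is asked of the dominating [h], so the kernel may enter [k] as it
    is. *)
Lemma normr_Rintegral_le_dominated {d : measure_display} {T : measurableType d}
    (nu : {measure set T -> \bar R}) (D : set T) (k h : T -> R) (M : R) :
  measurable D -> (nu D < +oo)%E -> measurable_fun D h -> 0 <= M ->
  (forall x, D x -> `|k x| <= `|h x|) ->
  {ae nu, forall x, D x -> `|h x| <= M} ->
  `|Rintegral nu D k| <= M * fine (nu D).
Proof.
move=> mD nuD mh M0 kh hM.
have nuD_fin : nu D \is a fin_num by rewrite ge0_fin_numE.
have bnd (g : T -> \bar R) : (forall x, D x -> 0 <= g x)%E ->
    (forall x, D x -> g x <= `|h x|%:E)%E ->
    exists2 r : R, (\int[nu]_(x in D) g x = r%:E)%E & 0 <= r <= M * fine (nu D).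
  move=> g0 gh.
  have I0 : (0 <= \int[nu]_(x in D) g x)%E by exact: integral_ge0.
  have IM : (\int[nu]_(x in D) g x <= (M * fine (nu D))%:E)%E.
    apply: le_trans (le_lower_integral nu D _ _ g0 gh) _.
    rewrite EFinM fineK//.
    by apply: (@integral_le_bound _ _ _ nu D (EFin \o h)) => //; exact/measurable_EFinP.
  move: I0 IM; case: integral => [r| |]//; rewrite !lee_fin => r0 rM.
  by exists r => //; rewrite r0.
have [||r1 r1E /andP[r10 r1M]] := bnd ((EFin \o k)^\+)%E.
  by move=> x _; rewrite funeposE le_max lexx orbT.
  by move=> x Dx; rewrite funeposE /= ge_max !lee_fin normr_ge0 andbT
    (le_trans (ler_norm _))// kh.
have [||r2 r2E /andP[r20 r2M]] := bnd ((EFin \o k)^\-)%E.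
  by move=> x _; rewrite funenegE le_max lexx orbT.
  by move=> x Dx; rewrite funenegE /= ge_max !lee_fin normr_ge0 andbT
    (le_trans (ler_norm _))// normrN kh.
rewrite /Rintegral integralE r1E r2E -EFinB /= ler_norml; apply/andP; split; lra.
Qed.

Lemma ae_neq_lebesgue (x : R) : {ae mu, forall y, y != x}.
Proof.
exists [set x]; split; [exact: measurable_set1|exact: lebesgue_measure_set1|].
by move=> y /= /negP; rewrite negbK => /eqP.
Qed.

Lemma fine_Linf_norm_ge0 (T : R) (h : R -> R) : 0 <= fine (Linf_norm T h).
Proof.
apply/fine_ge0/ess_sup_ger => [|t]; last by rewrite lee_fin; case: ifP.
(* A lower bound on an essential supremum requires a space of positive measure; the unit interval
   witnesses this for the line. *)
apply: (@lt_le_trans _ _ (mu `[0, 1])).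
  by rewrite lebesgue_measure_itv/= lte_fin ltr01 sube0 lte_fin.
by apply: le_measure; rewrite ?inE.
Qed.

Lemma ae_le_Linf_norm (T : R) (h : R -> R) : inLinf T h ->
  {ae mu, forall t, `[0, T]%classic t -> `|h t| <= fine (Linf_norm T h)}.
Proof.
move=> [_ hoo].
have := ess_sup_ge mu (fun t => ((if t \in `]0%R, T[ then `|h t| else 0))%:E).
(* The norm only sees the open interval; discarding the null points 0 and [T] reaches the closed
   one. *)
move: (ae_neq_lebesgue 0) (ae_neq_lebesgue T).
apply: (@filterS3 _ _ (ae_filter_ringOfSetsType mu)) => t t0 tT hE.
rewrite /= in_itv/= => /andP[t0' tT'].
have tin : t \in `]0, T[ by rewrite in_itv/= !lt_neqAle eq_sym t0 t0' tT tT'.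
rewrite tin -/(Linf_norm T h) in hE.
rewrite -lee_fin fineK// fin_numElt hoo andbT.
by apply: lt_le_trans hE; exact: ltNyr.
Qed.

Lemma normr_Rintegral_weighted_le (T t : R) (h e : R -> R) : inLinf T h ->
  0 <= t <= T -> (forall x, 0 <= x <= t -> 0 <= e x <= 1) ->
  `|Rintegral mu `[0, t] (fun x => h x * e x)| <= T * fine (Linf_norm T h).
Proof.
move=> hT /andP[t0 tT] e01.
have sub : `[0, t] `<=` `[0, T] by apply: subset_itvl; rewrite bnd_simp.
have mut : mu `[0, t] = t%:E.
  rewrite lebesgue_measure_itv/= lte_fin; case: ltP => [_|t0']; first by rewrite sube0.
  by congr EFin; apply/eqP; rewrite eq_le t0 t0'.
apply: (@le_trans _ _ (fine (Linf_norm T h) * t)); last first.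
  by rewrite mulrC ler_wpM2r// fine_Linf_norm_ge0.
rewrite -[X in _ * X]/(fine t%:E) -mut.
apply: (@normr_Rintegral_le_dominated _ _ mu _ _ h) => //.
- by have := ltry t; rewrite -mut.
- have [mh _] := hT; apply: measurable_funS sub _ => //.
  by apply/measurable_fun_itv_bndo_bndcP/measurable_fun_itv_obnd_cbndP.
- exact: fine_Linf_norm_ge0.
- move=> x; rewrite /= in_itv/= => /e01 /andP[e0 e1].
  by rewrite normrM (ger0_norm e0) ler_piMr.
- move: (ae_le_Linf_norm T h hT).
  by apply: (@filterS _ _ (ae_filter_ringOfSetsType mu)) => x hx /sub; exact: hx.
Qed.

End bounded_integrals.

(** * Range and monotonicity of the exponential kernel *)

Section kernel.
Context {R : realType}.
Variables (T a0 a1 : R) (a : R -> R).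
Hypotheses (a0_gt0 : 0 < a0) (ma : measurable_fun `[0, T] a).
Hypothesis aT : forall t, 0 <= t <= T -> a0 <= a t <= a1.
Local Notation mu := (@lebesgue_measure R).

Lemma Aint_ge0 (x t : R) : 0 <= x -> t <= T -> 0 <= Aint a x t.
Proof.
move=> x0 tT; apply: Rintegral_ge0 => y; rewrite /= in_itv/= => /andP[xy yt].
have /andP[? _] : a0 <= a y <= a1 by rewrite aT// (le_trans x0)// (le_trans yt).
by rewrite (le_trans (ltW a0_gt0)).
Qed.

(** Since [fine] sends infinity to 0, monotonicity in the interval needs the larger integral to be
    finite; the upper bound [a1] provides this. *)
Lemma Aint_nonincreasing (x y t : R) : 0 <= x -> x <= y -> t <= T ->
  Aint a y t <= Aint a x t.
Proof.
move=> x0 xy tT.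
have subx : `[x, t] `<=` `[0, T].
  by move=> z; rewrite /= !in_itv/= => /andP[xz zt];
    rewrite (le_trans x0)// (le_trans zt).
have suby : `[y, t] `<=` `[x, t] by apply: subset_itvr; rewrite bnd_simp.
have mx : measurable_fun `[x, t] a by apply: measurable_funS subx _.
have a_ge0 z : `[x, t]%classic z -> 0 <= a z.
  move=> /subx; rewrite /= in_itv/= => /aT /andP[? _].
  by rewrite (le_trans (ltW a0_gt0)).
have le_yx : (\int[mu]_(z in `[y, t]) (a z)%:E <= \int[mu]_(z in `[x, t]) (a z)%:E)%E.
  by apply: ge0_subset_integral => //; exact/measurable_EFinP.
have x_fin : (\int[mu]_(z in `[x, t]) (a z)%:E < +oo)%E.
  have mux : (mu `[x, t] < +oo)%E.
    by rewrite lebesgue_measure_itv/=; case: ifP => _; rewrite ?ltry// -EFinB ltry.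
  (* The absolute value secures a nonnegative constant: if [0, T] is empty, nothing constrains the
     sign of [a1]. *)
  apply: (@le_lt_trans _ _ (\int[mu]_(z in `[x, t]) (cst `|a1|%:E z)))%E.
    apply: le_lower_integral => z zxt; first by rewrite lee_fin a_ge0.
    move: zxt => /subx; rewrite /= in_itv/= lee_fin => /aT /andP[_ az].
    exact: le_trans az (ler_norm _).
  by rewrite integral_cst//; apply: lte_mul_pinfty; rewrite ?lee_fin.
have y_ge0 : (0 <= \int[mu]_(z in `[y, t]) (a z)%:E)%E.
  by apply: integral_ge0 => z /suby; rewrite lee_fin; exact: a_ge0.
rewrite /Aint /Rintegral fine_le// ge0_fin_numE//.
- exact: le_lt_trans le_yx x_fin.
- exact: le_trans y_ge0 le_yx.
Qed.

Lemma expR_Aint_itv01 (l x t : R) : 0 <= l -> 0 <= x -> t <= T ->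
  0 <= expR (- l * Aint a x t) <= 1.
Proof.
move=> l0 x0 tT; rewrite expR_ge0/= -expR0 ler_expR mulNr oppr_le0.
by rewrite mulr_ge0// Aint_ge0.
Qed.

Lemma expR_Aint_nondecreasing (l x y t : R) : 0 <= l -> 0 <= x -> x <= y ->
  t <= T -> expR (- l * Aint a x t) <= expR (- l * Aint a y t).
Proof.
move=> l0 x0 xy tT; rewrite ler_expR !mulNr lerN2 ler_wpM2l//.
exact: Aint_nonincreasing.
Qed.

End kernel.

(** * Finite sums under the integral sign *)

Section finite_sum_Rintegral.
Context {d : measure_display} {T : measurableType d} {R : realType}.
Variables (mu : {measure set T -> \bar R}) (D : set T).
Hypothesis mD : measurable D.

Lemma integrable_sum_EFin n (f : nat -> T -> R) :
  (forall i, mu.-integrable D (EFin \o f i)) ->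
  mu.-integrable D (EFin \o (fun x => \sum_(i < n) f i x)).
Proof.
move=> fi; apply: (@eq_integrable _ _ _ mu D mD
    (fun x => (\sum_(i < n) (f i x)%:E)%E)).
  by move=> x _ /=; rewrite sumEFin.
by apply: integrable_sum => // i _; exact: fi.
Qed.

Lemma Rintegral_sum n (f : nat -> T -> R) :
  (forall i, mu.-integrable D (EFin \o f i)) ->
  Rintegral mu D (fun x => \sum_(i < n) f i x) =
  \sum_(i < n) Rintegral mu D (f i).
Proof.
move=> fi; elim: n => [|n IH].
  rewrite big_ord0; under eq_Rintegral do rewrite big_ord0.
  by rewrite Rintegral_cst// mul0r.
rewrite big_ord_recr/= -IH -RintegralD//; last exact: integrable_sum_EFin.
by apply: eq_Rintegral => x _; rewrite big_ord_recr.
Qed.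

Lemma integrableZ_EFin (k : R) (f : T -> R) : mu.-integrable D (EFin \o f) ->
  mu.-integrable D (EFin \o (fun x => k * f x)).
Proof.
move=> fi; apply: (@eq_integrable _ _ _ mu D mD (fun x => (k%:E * (f x)%:E)%E)) => //.
exact: integrableZl.
Qed.

Lemma integrableD_EFin (f g : T -> R) : mu.-integrable D (EFin \o f) ->
  mu.-integrable D (EFin \o g) ->
  mu.-integrable D (EFin \o (fun x => f x + g x)).
Proof.
move=> fi gi; apply: (@eq_integrable _ _ _ mu D mD
    (fun x => ((f x)%:E + (g x)%:E)%E)) => //.
exact: (integrableD mD fi gi).
Qed.

End finite_sum_Rintegral.

(** * Orthonormal families and Bessel's inequality *)

Section orthonormal.
Context {d : measure_display} {T : measurableType d} {R : realType}.
Variables (mu : {measure set T -> \bar R}) (D : set T) (e : nat -> T -> R).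
Hypothesis mD : measurable D.
Hypothesis e_int : forall i j, mu.-integrable D (EFin \o (fun x => e i x * e j x)).
Hypothesis e_on : forall i j, Rintegral mu D (fun x => e i x * e j x) = (i == j)%:R.

Let sqr_sumE n (c : nat -> R) x : (\sum_(i < n) c i * e i x) ^+ 2 =
  \sum_(i < n) \sum_(j < n) c i * c j * (e i x * e j x).
Proof.
rewrite expr2 big_distrlr/=; apply: eq_bigr => i _; apply: eq_bigr => j _.
by rewrite mulrACA.
Qed.

Lemma integrable_sqr_orthonormal_sum n (c : nat -> R) :
  mu.-integrable D (EFin \o (fun x => (\sum_(i < n) c i * e i x) ^+ 2)).
Proof.
rewrite (_ : (fun x => _) = (fun x =>
    \sum_(i < n) \sum_(j < n) c i * c j * (e i x * e j x))); last first.
  by apply/funext => x; rewrite sqr_sumE.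
apply: (integrable_sum_EFin mu D mD n
  (fun i x => \sum_(j < n) c i * c j * (e i x * e j x))) => i.
apply: (integrable_sum_EFin mu D mD n
  (fun j x => c i * c j * (e i x * e j x))) => j.
exact: integrableZ_EFin.
Qed.

Lemma Rintegral_sqr_orthonormal_sum n (c : nat -> R) :
  Rintegral mu D (fun x => (\sum_(i < n) c i * e i x) ^+ 2) =
  \sum_(i < n) c i ^+ 2.
Proof.
have int_ij i j : mu.-integrable D (EFin \o (fun x => c i * c j * (e i x * e j x))).
  exact: integrableZ_EFin.
under eq_Rintegral do rewrite sqr_sumE.
rewrite (Rintegral_sum mu D mD n
  (fun i x => \sum_(j < n) c i * c j * (e i x * e j x))); last first.
  by move=> i; apply: (integrable_sum_EFin mu D mD n
    (fun j x => c i * c j * (e i x * e j x))).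
apply: eq_bigr => i _.
rewrite (Rintegral_sum mu D mD n (fun j x => c i * c j * (e i x * e j x)))//.
rewrite (bigD1 i)//= big1 ?addr0 => [|j ji].
  by rewrite RintegralZl// e_on eqxx mulr1 expr2.
rewrite RintegralZl// e_on eq_sym -[_ == _ :> nat]/(_ == _ :> 'I_n).
by rewrite (negbTE ji) mulr0.
Qed.

(** The squared distance from [F] to its projection is nonnegative. Expanded, the cross term gives
    -2 times the sum of the [b i ^+ 2] and orthonormality turns the last square into that sum
    once. *)
Lemma bessel_inequality n (F : T -> R) :
  mu.-integrable D (EFin \o (fun x => F x ^+ 2)) ->
  (forall i, mu.-integrable D (EFin \o (fun x => F x * e i x))) ->
  \sum_(i < n) (Rintegral mu D (fun x => F x * e i x)) ^+ 2 <=
  Rintegral mu D (fun x => F x ^+ 2).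
Proof.
move=> F2 Fe; pose b i := Rintegral mu D (fun x => F x * e i x).
have ge0 : 0 <= Rintegral mu D (fun x => (F x - \sum_(i < n) b i * e i x) ^+ 2).
  by apply: Rintegral_ge0 => x _; rewrite sqr_ge0.
have bFe : mu.-integrable D (EFin \o (fun x => \sum_(i < n) (-2 * b i) * (F x * e i x))).
  apply: (integrable_sum_EFin mu D mD n (fun i x => (-2 * b i) * (F x * e i x))) => i.
  exact: integrableZ_EFin.
have E x : (F x - \sum_(i < n) b i * e i x) ^+ 2 = F x ^+ 2 +
    \sum_(i < n) (-2 * b i) * (F x * e i x) + (\sum_(i < n) b i * e i x) ^+ 2.
  rewrite (_ : \sum_(i < n) -2 * b i * _ = -2 * F x * \sum_(i < n) b i * e i x).
    by ring.
  by rewrite mulr_sumr; apply: eq_bigr => i _; ring.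
move: ge0; under eq_Rintegral do rewrite E.
rewrite RintegralD//; last first.
- exact: integrable_sqr_orthonormal_sum.
- exact: integrableD_EFin.
rewrite RintegralD// Rintegral_sqr_orthonormal_sum.
rewrite (Rintegral_sum mu D mD n (fun i x => (-2 * b i) * (F x * e i x))); last first.
  by move=> i; exact: integrableZ_EFin.
rewrite (eq_bigr (fun i : 'I_n => -2 * b i ^+ 2)); last first.
  by move=> i _; rewrite RintegralZl// -/(b i) expr2 mulrA.
rewrite -mulr_sumr; lra.
Qed.

End orthonormal.

(** * The radial eigenfunctions *)

Section radial_basis.
Context {R : realType}.
Variable R0 : R.
Hypothesis R0_gt0 : 0 < R0.
Local Notation mu := (@lebesgue_measure R).
Local Notation D := (`[0, R0]%classic : set R).

(** This is sqrt(2 / R0) sin((i+1) pi r / R0), that is, r times mode i+1. Multiplying by r turns the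
    weighted space into the plain L^2 on [0, R0] and removes the quotient at 0; the shift makes
    indices start at 0. *)
Definition radial_sine (i : nat) (r : R) : R :=
  Num.sqrt 2 * R0 / Num.sqrt (R0 ^+ 3) * sin (i.+1%:R * pi * r / R0).

Lemma omega_radial_sine i r : r * omega R0 i.+1 r = radial_sine i r.
Proof.
have sq0 : Num.sqrt (R0 ^+ 3) != 0 by rewrite gt_eqF// sqrtr_gt0 exprn_gt0.
have pi0 : (pi : R) != 0 by rewrite gt_eqF// pi_gt0.
have i0 : (i.+1%:R : R) != 0 by rewrite pnatr_eq0.
rewrite /omega /radial_sine; case: eqVneq => [->|r0].
  by rewrite mulr0 !mul0r sin0 mulr0.
move: (sin _) => s; move: (pi : R) pi0 (i.+1%:R : R) i0 => p p0 m m0.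
by field; rewrite ?r0 ?p0 ?m0 ?sq0 ?gt_eqF.
Qed.

Lemma continuous_radial_sine i : continuous (radial_sine i).
Proof.
by move=> r; apply/differentiable_continuous/derivable1_diffP; apply: ex_derive.
Qed.

Lemma continuous_integrable_itv (f : R -> R) : continuous f ->
  mu.-integrable D (EFin \o f).
Proof.
move=> cf; apply: continuous_compact_integrable; first exact: segment_compact.
exact: continuous_subspaceT.
Qed.

Lemma sin_natr_pi n : sin (n%:R * pi) = 0 :> R.
Proof.
elim: n => [|n IH]; first by rewrite mul0r sin0.
by rewrite -natr1 mulrDl mul1r sinDpi IH oppr0.
Qed.

Lemma continuous_cos_scale (c : R) : continuous (fun r => cos (c * r)).
Proof.
by move=> r; apply/differentiable_continuous/derivable1_diffP; apply: ex_derive.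
Qed.

Lemma Rintegral_cos_scale (c : R) : c != 0 ->
  Rintegral mu D (fun r => cos (c * r)) = sin (c * R0) / c.
Proof.
move=> c0; pose F r := sin (c * r) / c.
have dF (r : R) : is_derive r 1 F (cos (c * r)).
  by apply: is_derive_eq; rewrite /GRing.scale/=; field.
have cF : continuous F.
  by move=> r; apply/differentiable_continuous/derivable1_diffP; exact: ex_derive.
rewrite /Rintegral (@continuous_FTC2 _ _ F 0 R0)//.
- by rewrite /F mulr0 sin0 mul0r sube0.
- by apply: continuous_subspaceT; exact: continuous_cos_scale.
- split.
  + by move=> r _; exact: ex_derive.
  + by apply: cvg_at_right_filter; exact: cF.
  + by apply: cvg_at_left_filter; exact: cF.
- by move=> r _; rewrite derive1E; exact: derive_val.
Qed.

(** The product of sines is a difference of cosines at the difference frequency [al] and the sum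
    frequency [be]. Both integrate to a sine at a multiple of pi, hence to 0, except that [al]
    vanishes when [i = j] and then contributes the length [R0]. *)
Lemma radial_sine_orthonormal i j :
  Rintegral mu D (fun r => radial_sine i r * radial_sine j r) = (i == j)%:R.
Proof.
pose al := (i%:R - j%:R) * pi / R0; pose be := (i + j).+2%:R * pi / R0.
have pi0 : (pi : R) != 0 by rewrite gt_eqF// pi_gt0.
have R00 : R0 != 0 by rewrite gt_eqF.
have be0 : be != 0 by rewrite !mulf_neq0 ?invr_eq0// pnatr_eq0.
have coscos c : mu.-integrable D (EFin \o (fun r => cos (c * r))).
  by apply: continuous_integrable_itv; exact: continuous_cos_scale.
have E r : radial_sine i r * radial_sine j r =
    R0^-1 * (cos (al * r) - cos (be * r)).
  have -> : al * r = i.+1%:R * pi * r / R0 - j.+1%:R * pi * r / R0.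
    by rewrite /al -!natr1; move: (pi : R) => p; field.
  have -> : be * r = i.+1%:R * pi * r / R0 + j.+1%:R * pi * r / R0.
    by rewrite /be -addSn -addnS natrD; move: (pi : R) => p; field.
  rewrite cosB cosD /radial_sine mulrACA.
  have -> : Num.sqrt 2 * R0 / Num.sqrt (R0 ^+ 3) *
      (Num.sqrt 2 * R0 / Num.sqrt (R0 ^+ 3)) = 2 / R0.
    rewrite -expr2 !exprMn exprVn !sqr_sqrtr// ?exprn_ge0 ?ltW//.
    by field.
  by field.
under eq_Rintegral do rewrite E.
rewrite RintegralZl//; last first.
  apply: continuous_integrable_itv => r.
  by apply: continuousB; exact: continuous_cos_scale.
rewrite RintegralB// (Rintegral_cos_scale be be0).
rewrite (_ : be * R0 = (i + j).+2%:R * pi) ?sin_natr_pi ?mul0r ?subr0; last first.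
  by rewrite /be divfK.
have [ij|ij] := eqVneq i j.
  rewrite (_ : al = 0); last by rewrite /al ij subrr !mul0r.
  under eq_Rintegral do rewrite mul0r cos0.
  have muD : mu D = R0%:E by rewrite lebesgue_measure_itv/= lte_fin R0_gt0 sube0.
  rewrite Rintegral_cst// (_ : fine _ = R0) ?mul1r ?mulVf//.
  by rewrite -[RHS]/(fine R0%:E) -muD.
rewrite Rintegral_cos_scale; last first.
  by rewrite !mulf_neq0 ?invr_eq0// subr_eq0 eqr_nat.
rewrite (_ : al * R0 = i%:R * pi - j%:R * pi); last by rewrite /al divfK// mulrBl.
by rewrite sinB !sin_natr_pi mul0r mulr0 subrr mul0r mulr0.
Qed.

Lemma integrable_radial_sineM i j :
  mu.-integrable D (EFin \o (fun r => radial_sine i r * radial_sine j r)).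
Proof.
apply: continuous_integrable_itv => r.
by apply: continuousM; exact: continuous_radial_sine.
Qed.

Lemma integrable_sqr_L2w (f : R -> R) : inL2w R0 f ->
  mu.-integrable D (EFin \o (fun r => (r * f r) ^+ 2)).
Proof.
move=> [mf foo]; apply/integrableP; split.
  apply/measurable_EFinP; apply: measurable_funX; apply: measurable_funM => //.
apply: le_lt_trans foo; apply: le_lower_integral => r _; first exact: abse_ge0.
by rewrite /= lee_fin ger0_norm ?sqr_ge0// exprMn.
Qed.

(** Splitting the weight as r * r makes each coefficient a plain inner product of [r * f r] with a
    [radial_sine]. *)
Lemma bessel_L2w (f : R -> R) N : inL2w R0 f ->
  \sum_(1 <= n < N.+1) coef R0 f n ^+ 2 <= fine (L2w_sq R0 f).
Proof.
move=> fL; have iF := integrable_sqr_L2w f fL; have [mf _] := fL.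
rewrite big_add1/= big_mkord.
have -> : fine (L2w_sq R0 f) = Rintegral mu D (fun r => (r * f r) ^+ 2).
  by congr fine; apply: eq_integral => r _; rewrite exprMn.
have coefE i : coef R0 f i.+1 =
    Rintegral mu D (fun r => (r * f r) * radial_sine i r).
  by apply: eq_Rintegral => r _; rewrite -omega_radial_sine; ring.
under eq_bigr do rewrite coefE.
apply: (bessel_inequality mu D radial_sine) => //.
- exact: integrable_radial_sineM.
- exact: radial_sine_orthonormal.
move=> i.
have ms : measurable_fun D (radial_sine i).
  by apply: measurable_funTS; apply: continuous_measurable_fun;
    exact: continuous_radial_sine.
(* The product is integrable because |x y| <= x^2 + y^2. *)
apply: (@le_integrable _ _ _ mu D _ _ (EFin \o (fun r =>
    (r * f r) ^+ 2 + radial_sine i r * radial_sine i r))) => //.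
- by apply/measurable_EFinP; apply: measurable_funM => //; exact: measurable_funM.
- move=> r _ /=; rewrite lee_fin.
  set x := r * f r; set y := radial_sine i r.
  rewrite [leRHS]ger0_norm ?addr_ge0 -?expr2 ?sqr_ge0// normrM.
  have := sqr_ge0 (`|x| - `|y|); have := sqr_ge0 (`|x| + `|y|).
  by rewrite -[x ^+ 2]real_normK ?num_real// -[y ^+ 2]real_normK ?num_real//; nra.
- by apply: integrableD_EFin => //; exact: integrable_radial_sineM.
Qed.

Lemma sqr_omega_sumE (c : nat -> R) N r :
  r ^+ 2 * (\sum_(1 <= n < N.+1) c n * omega R0 n r) ^+ 2 =
  (\sum_(i < N) c i.+1 * radial_sine i r) ^+ 2.
Proof.
rewrite -exprMn mulr_sumr big_add1/= big_mkord; congr (_ ^+ 2).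
by apply: eq_bigr => i _; rewrite -omega_radial_sine; ring.
Qed.

Lemma L2w_sq_omega_sum (c : nat -> R) N :
  L2w_sq R0 (fun r => \sum_(1 <= n < N.+1) c n * omega R0 n r) =
  (\sum_(1 <= n < N.+1) c n ^+ 2)%:E.
Proof.
rewrite big_add1/= big_mkord.
rewrite -(Rintegral_sqr_orthonormal_sum mu D radial_sine _ integrable_radial_sineM
  radial_sine_orthonormal N (fun i => c i.+1))//.
rewrite /L2w_sq /Rintegral fineK; first by apply: eq_integral => r _; rewrite sqr_omega_sumE.
apply: integrable_fin_num => //.
exact: (integrable_sqr_orthonormal_sum mu D radial_sine _ integrable_radial_sineM
  N (fun i => c i.+1)).
Qed.

Lemma measurable_omega_sum (c : nat -> R) N : measurable_fun D (fun r =>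
  (r ^+ 2 * (\sum_(1 <= n < N.+1) c n * omega R0 n r) ^+ 2)%:E).
Proof.
rewrite (_ : (fun r => _) = EFin \o (fun r =>
    (\sum_(i < N) c i.+1 * radial_sine i r) ^+ 2)); last first.
  by apply/funext => r; rewrite sqr_omega_sumE.
apply: (measurable_int mu).
exact: (integrable_sqr_orthonormal_sum mu D radial_sine _ integrable_radial_sineM
  N (fun i => c i.+1)).
Qed.

End radial_basis.

(** * Tonelli's theorem when one variable ranges over a subset *)

Section tonelli_on_subset.
Context {d1 d2 : measure_display} {X : measurableType d1} {Y : measurableType d2}.
Context {R : realType}.
Variables (m1 : {sigma_finite_measure set X -> \bar R}).
Variables (m2 : {sigma_finite_measure set Y -> \bar R}).
Variables (D : set X) (G : X -> Y -> \bar R).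
Hypotheses (mD : measurable D) (G0 : forall x y, D x -> (0 <= G x y)%E).
Hypothesis mG : measurable_fun (D `*` setT) (fun p : X * Y => G p.1 p.2).

(** Extension by zero reduces everything here to Tonelli on the full product. *)
Let G' := (fun p : X * Y => G p.1 p.2) \_ (D `*` setT).

Let G'_ge0 p : (0 <= G' p)%E.
Proof. by apply: erestrict_ge0 => -[x y] [/= Dx _]; exact: G0. Qed.

Let mG' : measurable_fun setT G'.
Proof. by apply/(measurable_restrictT _ _).1 => //; exact: measurableX. Qed.

Let G'E x y : G' (x, y) = ((G ^~ y) \_ D) x.
Proof.
rewrite /G' !patchE; have [xD|xD] := boolP (x \in D).
  by rewrite ifT// inE; split => //=; exact: set_mem.
by rewrite ifF//; apply/negbTE; apply: contra xD; rewrite !inE => -[].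
Qed.

Let fubini_GE : (fun y => (\int[m1]_(x in D) G x y)%E) = fubini_G m1 G'.
Proof.
apply/funext => y; rewrite integral_mkcond; apply: eq_integral => x _.
by rewrite G'E.
Qed.

Lemma measurable_section_subset y : measurable_fun D (G ^~ y).
Proof.
apply/(measurable_restrictT _ mD).2.
rewrite (_ : _ \_ _ = G' \o (fun x => (x, y))); last first.
  by apply/funext => x /=; rewrite G'E.
exact: measurableT_comp.
Qed.

Lemma measurable_integral_subset :
  measurable_fun setT (fun y => (\int[m1]_(x in D) G x y)%E).
Proof. by rewrite fubini_GE; exact: measurable_fun_fubini_tonelli_G. Qed.

Lemma tonelli_subset : (\int[m2]_y \int[m1]_(x in D) G x y =
  \int[m1]_(x in D) \int[m2]_y G x y)%E.
Proof.
rewrite fubini_GE -(@fubini_tonelli _ _ _ _ _ m1 m2 _ mG' G'_ge0) [RHS]integral_mkcond.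
apply: eq_integral => x _; rewrite /fubini_F patchE; case: ifPn => xD.
  by apply: eq_integral => y _; rewrite G'E patchE xD.
by apply: integral0_eq => y _; rewrite G'E patchE (negbTE xD).
Qed.

End tonelli_on_subset.

(** * Splitting the energy at a partial sum *)

Section energy.
Context {R : realType} {d : measure_display} {Omega : measurableType d}.
Variables (P : probability Omega R) (R0 T : R).
Hypotheses (R0_gt0 : 0 < R0).
Local Notation mu := (@lebesgue_measure R).

Let L2w_sq_ge0 phi : (0 <= L2w_sq R0 phi)%E.
Proof. by apply: integral_ge0 => r _; rewrite lee_fin mulr_ge0 ?sqr_ge0. Qed.

(** From (p - 2 S)^2 >= 0 comes p^2 <= 2 (p - S)^2 + 2 S^2. The finite sum S is the measurable
    summand, and its norm is explicit by orthonormality. *)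
Lemma L2w_sq_le_omega_sum (phi : R -> R) (c : nat -> R) N :
  (L2w_sq R0 phi <=
   2%:E * L2w_sq R0 (fun r => phi r - \sum_(1 <= n < N.+1) c n * omega R0 n r)%R
   + (2 * \sum_(1 <= n < N.+1) c n ^+ 2)%:E)%E.
Proof.
rewrite EFinM -(L2w_sq_omega_sum R0 R0_gt0) /L2w_sq.
have mS := measurable_omega_sum R0 R0_gt0 c N.
rewrite -[X in (_ <= _ + X)%E]ge0_integralZl_EFin//; last first.
  by move=> r _; rewrite lee_fin mulr_ge0 ?sqr_ge0.
apply: le_lower_integral_affine => //.
- by move=> r _; rewrite lee_fin mulr_ge0 ?sqr_ge0.
- by move=> r _; rewrite -EFinM lee_fin mulr_ge0// mulr_ge0 ?sqr_ge0.
- by move=> r _; rewrite lee_fin mulr_ge0 ?sqr_ge0.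
- exact: measurable_funeM.
- move=> r _; rewrite -!EFinM -EFinD lee_fin.
  set S := \sum_(1 <= n < N.+1) _; set p := phi r.
  have : p ^+ 2 <= 2 * (p - S) ^+ 2 + 2 * S ^+ 2.
    by have := sqr_ge0 (p - 2 * S); nra.
  by move/(ler_wpM2l (sqr_ge0 r)); lra.
Qed.

(** The splitting is integrated over time, then over [Omega]. The jointly measurable majorant [G]
    replaces the squared coefficients, so that Tonelli can bring the expectation inside, where
    variances are bounded at each fixed time. *)
Lemma energy_le_omega_sum (u : Omega -> R -> R -> R) (c : nat -> R -> Omega -> R)
    (G : R -> Omega -> R) N :
  measurable_fun (`[0%R, T] `*` setT) (fun p : R * Omega => G p.1 p.2) ->
  (forall t w, 0 <= t <= T -> 2 * \sum_(1 <= n < N.+1) c n t w ^+ 2 <= G t w) ->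
  (\int[P]_w \int[mu]_(t in `[0%R, T]) L2w_sq R0 (fun r => u w r t) <=
   2%:E * \int[P]_w \int[mu]_(t in `[0%R, T]) L2w_sq R0 (fun r =>
     u w r t - \sum_(1 <= n < N.+1) c n t w * omega R0 n r)%R +
   \int[mu]_(t in `[0%R, T]) \int[P]_w (G t w)%:E)%E.
Proof.
move=> mG cG.
have G0 t w : `[0, T]%classic t -> (0 <= (G t w)%:E)%E.
  rewrite /= in_itv/= lee_fin => tT; apply: le_trans (cG t w tT).
  by rewrite mulr_ge0// sumr_ge0// => n _; rewrite sqr_ge0.
have mG' : measurable_fun (`[0, T] `*` setT) (fun p : R * Omega => (G p.1 p.2)%:E).
  exact/measurable_EFinP.
rewrite -(@tonelli_subset _ _ _ _ _ mu P _ (fun t w => (G t w)%:E))//.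
apply: le_lower_integral_affine => //.
- by move=> w _; apply: integral_ge0 => t _.
- by move=> w _; apply: integral_ge0 => t /G0.
- by move=> w _; apply: integral_ge0 => t _.
- exact: (@measurable_integral_subset _ _ _ _ _ mu _ (fun t w => (G t w)%:E)).
move=> w _; apply: le_lower_integral_affine => //.
- by move=> t /G0.
- exact: (@measurable_section_subset _ _ _ _ _ _ (fun t w => (G t w)%:E)).
move=> t; rewrite /= in_itv/= => tT.
apply: le_trans (@L2w_sq_le_omega_sum _ (fun n => c n t w) N) _.
by rewrite leeD2l// lee_fin; exact: cG.
Qed.

End energy.

(** * Assembly of the energy estimate *)

Lemma two_sqrD_le {R : realFieldType} (x y : R) :
  (x + y) ^+ 2 <= 2 * x ^+ 2 + 2 * y ^+ 2.
Proof. by have := sqr_ge0 (x - y); nra. Qed.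

Theorem theorem3p1 (R : realType) (R0 T a0 a1 H : R) (a : R -> R)
    (d : measure_display) (Omega : measurableType d)
    (P : probability Omega R) (B : R -> Omega -> R) :
  0 < R0 -> 0 < T -> 0 < a0 ->
  measurable_fun `[0%R, T] a ->
  (forall t, 0 <= t <= T -> a0 <= a t <= a1) ->
  0 < H < 1 ->
  is_fBm P H B ->
  exists C : R, 0 < C /\
  forall (f g h : R -> R) (Ch : R) (Y : nat -> R -> Omega -> R)
         (u : Omega -> R -> R -> R),
    inL2w R0 f -> inL2w R0 g -> L2w_sq R0 g != 0%E ->
    inLinf T h -> 0 < Ch ->
    (\forall t \ae lebesgue_measure, 0 < t < T -> Ch <= h t) ->
    (* Y n t = \int_0^t exp(-lam_n \int_tau^t a) dB^H(tau)  (Wiener integral) *)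
    (forall n t, 0 <= t <= T ->
       wiener_integral P B (fun tau => expR (- lam R0 n * Aint a tau t)) t (Y n t)) ->
    (forall n, measurable_fun (`[0%R, T] `*` setT) (fun p : R * Omega => Y n p.1 p.2)) ->
    measurable_fun (setT `*` (`[0%R, R0] `*` `[0%R, T]))
      (fun p : Omega * (R * R) => u p.1 p.2.1 p.2.2) ->
    (* u is the mild solution: the series converges to u in L^2(Omega x D x [0,T]) *)
    ((fun N : nat => (
        \int[P]_w \int[lebesgue_measure]_(t in `[0%R, T])
          L2w_sq R0 (fun r => (u w r t -
            \sum_(1 <= n < N.+1)
              (coef R0 f n *
                 Rintegral lebesgue_measure `[0%R, t]
                   (fun tau => h tau * expR (- lam R0 n * Aint a tau t))
               + coef R0 g n * Y n t w) * omega R0 n r)%R))%E)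
      @ \oo --> 0%E) ->
    (\int[P]_w \int[lebesgue_measure]_(t in `[0%R, T]) L2w_sq R0 (fun r => u w r t)
      <= (C * (T ^+ 3 * fine (L2w_sq R0 f) * fine (Linf_norm T h) ^+ 2
               + T `^ (2 * H + 1) / (2 * H + 1) * fine (L2w_sq R0 g)))%:E)%E.
Proof.
(* The argument yields 4 for the [f] term and 32 = 4 * 8 for the [g] term, where 8 comes from the
   Wiener integral. Creating the denominator [2 * H + 1 <= 3] costs a factor 3, whence 96. *)
move=> R0_gt0 T_gt0 a0_gt0 ma aT /andP[H_gt0 H_lt1] fBm; exists 96; split => //.
move=> f g h Ch Y u fL gL _ hL _ _ YW mY _ u_lim.
set M := fine (Linf_norm T h); set F := fine (L2w_sq R0 f).
set Gg := fine (L2w_sq R0 g).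
have L2w_fine_ge0 phi : 0 <= fine (L2w_sq R0 phi).
  by apply/fine_ge0/integral_ge0 => r _; rewrite lee_fin mulr_ge0 ?sqr_ge0.
have F_ge0 : 0 <= F := L2w_fine_ge0 f; have Gg_ge0 : 0 <= Gg := L2w_fine_ge0 g.
have M_ge0 : 0 <= M := fine_Linf_norm_ge0 T h.
have z_ge0 := powR_ge0 T (2 * H); set z := T `^ (2 * H) in z_ge0.
have lam_ge0 n : 0 <= lam R0 n by exact: sqr_ge0.
pose I n t := Rintegral lebesgue_measure `[0, t]
  (fun tau => h tau * expR (- lam R0 n * Aint a tau t)).
have I_le n t : 0 <= t <= T -> I n t ^+ 2 <= (T * M) ^+ 2.
  move=> tT; have /andP[_ t_le] := tT.
  rewrite -(real_normK (num_real (I n t))) ler_sqr ?nnegrE//; last first.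
    by rewrite mulr_ge0// ltW.
  apply: (normr_Rintegral_weighted_le T t h
    (fun tau => expR (- lam R0 n * Aint a tau t)) hL tT) => x /andP[x0 _].
  exact: (expR_Aint_itv01 T a0 a1).
have EY n t : 0 <= t <= T -> (\int[P]_w (Y n t w ^+ 2)%:E <= (8 * z)%:E)%E.
  move=> tT; have /andP[t_ge0 t_le] := tT.
  apply: le_trans (wiener_integral_second_moment_le P H B H_gt0 fBm _ _ _ t_ge0
    _ _ (YW n t tT)) _.
  - by move=> x /andP[x0 _]; exact: (expR_Aint_itv01 T a0 a1).
  - move=> x y x0 xy _; exact: (expR_Aint_nondecreasing T a0 a1).
  - rewrite lee_fin ler_wpM2l// /z; apply: ge0_ler_powR; rewrite ?nnegrE//.
    + by rewrite mulr_ge0// ltW.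
    + exact: ltW.
apply: (@le_trans _ _ (T * (4 * (T * M) ^+ 2 * F + 32 * z * Gg))%:E); last first.
  have -> : T `^ (2 * H + 1) = z * T.
    by rewrite powRD ?powRr1 ?ltW//; apply/implyP => _; rewrite gt_eqF.
  rewrite lee_fin.
  have -> : T * (4 * (T * M) ^+ 2 * F + 32 * z * Gg) =
      4 * (T ^+ 3 * F * M ^+ 2) + 32 * (z * T * Gg) by ring.
  rewrite mulrDr lerD//.
    rewrite ler_wpM2r// ?ler_nat// mulr_ge0 ?sqr_ge0// mulr_ge0//.
    by rewrite exprn_ge0// ltW.
  rewrite [z * T / _ * _]mulrAC [96 * _]mulrA ler_pdivlMr; last by lra.
  have zTG : 0 <= z * T * Gg by rewrite !mulr_ge0// ltW.
  have : z * T * Gg * H <= z * T * Gg * 1 by rewrite ler_wpM2l// ltW.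
  lra.
(* From here [N] is fixed, and the bound must not depend on it. *)
apply: (@cvg0_affine_le _ 2 _ _ _ u_lim) => N.
(* Each 4 is the 2 of the energy splitting times the 2 of [two_sqrD_le]. The deterministic part is
   already replaced by its bound through Bessel for [f], so time enters [G] only through the
   [Y n]. *)
pose G t w := 4 * (T * M) ^+ 2 * F +
  \sum_(1 <= n < N.+1) (4 * coef R0 g n ^+ 2) * Y n t w ^+ 2.
apply: le_trans (energy_le_omega_sum P R0 T R0_gt0 u
  (fun n t w => coef R0 f n * I n t + coef R0 g n * Y n t w) G N _ _) _.
- apply: measurable_funD => //; apply: measurable_sum => n.
  by apply: measurable_funM => //; exact: measurable_funX.
- move=> t w tT; rewrite /G.
  have fI : \sum_(1 <= n < N.+1) (coef R0 f n * I n t) ^+ 2 <= (T * M) ^+ 2 * F.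
    apply: (@le_trans _ _ (\sum_(1 <= n < N.+1) (T * M) ^+ 2 * coef R0 f n ^+ 2)).
      by apply: ler_sum => n _; rewrite exprMn mulrC ler_wpM2r ?sqr_ge0 ?I_le.
    by rewrite -mulr_sumr ler_wpM2l ?sqr_ge0// bessel_L2w.
  have : \sum_(1 <= n < N.+1) (coef R0 f n * I n t + coef R0 g n * Y n t w) ^+ 2 <=
      2 * \sum_(1 <= n < N.+1) (coef R0 f n * I n t) ^+ 2 +
      2 * \sum_(1 <= n < N.+1) (coef R0 g n * Y n t w) ^+ 2.
    rewrite !mulr_sumr -big_split/=; apply: ler_sum => n _; exact: two_sqrD_le.
  have -> : \sum_(1 <= n < N.+1) 4 * coef R0 g n ^+ 2 * Y n t w ^+ 2 =
      4 * \sum_(1 <= n < N.+1) (coef R0 g n * Y n t w) ^+ 2.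
    by rewrite mulr_sumr; apply: eq_bigr => n _; ring.
  lra.
rewrite leeD2l//.
apply: (@le_trans _ _ (\int[lebesgue_measure]_(t in `[0%R, T])
    cst (4 * (T * M) ^+ 2 * F + 32 * z * Gg)%:E t)%E); last first.
  rewrite integral_cst//.
  have muT : lebesgue_measure `[0, T] = T%:E.
    by rewrite lebesgue_measure_itv/= lte_fin T_gt0 sube0.
  by rewrite EFinM muleC -muT.
have cst_ge0 : 0 <= 4 * (T * M) ^+ 2 * F by rewrite mulr_ge0// mulr_ge0 ?sqr_ge0.
have cg_ge0 n : 0 <= 4 * coef R0 g n ^+ 2 by rewrite mulr_ge0 ?sqr_ge0.
apply: le_lower_integral => t; rewrite /= in_itv/= => tT.
  apply: integral_ge0 => w _; rewrite lee_fin addr_ge0// sumr_ge0// => n _.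
  by rewrite mulr_ge0 ?sqr_ge0.
have mYt n : measurable_fun setT (fun w => (Y n t w ^+ 2)%:E).
  by apply/measurable_EFinP/measurable_funX; have [] := YW n t tT.
under eq_integral do rewrite /G EFinD -sumEFin.
have mcY n : measurable_fun setT (fun w => (4 * coef R0 g n ^+ 2 * Y n t w ^+ 2)%:E).
  by under eq_fun do rewrite EFinM; exact: measurable_funeM.
have cY_ge0 n w : (0 <= (4 * coef R0 g n ^+ 2 * Y n t w ^+ 2)%:E)%E.
  by rewrite lee_fin mulr_ge0 ?sqr_ge0.
rewrite ge0_integralD//; last 2 first.
- by move=> w _; apply: sume_ge0.
- exact: emeasurable_sum.
rewrite (_ : (\int[P]_w _)%E = (4 * (T * M) ^+ 2 * F)%:E); last first.
  by rewrite -[RHS]mule1 -(probability_setT P); exact: integral_cst.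
rewrite EFinD leeD2l// ge0_integral_sum//.
(* The variance bound is uniform in [n], so it factors out and Bessel for [g] controls the remaining
   sum. *)
apply: (@le_trans _ _ (\sum_(1 <= n < N.+1) (4 * coef R0 g n ^+ 2 * (8 * z))%:E)%E).
  apply: lee_sum => n _; under eq_integral do rewrite EFinM.
  rewrite ge0_integralZl_EFin//; last by move=> w _; rewrite lee_fin sqr_ge0.
  by rewrite [leRHS]EFinM lee_wpmul2l ?lee_fin ?EY.
rewrite sumEFin lee_fin -mulr_suml -mulr_sumr.
have := bessel_L2w R0 R0_gt0 g N gL; rewrite -/Gg.
by move/(ler_wpM2l z_ge0); lra.
Qed.
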